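(* Let $M^3$ be a 3-dimensional contact metric manifold whose curvature tensor can be written simultaneously as $R=\sum_{i=1}^6 f_iR_i$ and as $R=\sum_{i=1}^6 f_i^{*}R_i$ for functions $f_i,f_i^{*}$ on $M$ ($i=1,\ldots,6$), where $f_1-f_3<1$. Then there exist functions $f$ and $\overline f$ on $M$ such that $$f_1^{*}=f_1+f,\quad f_2^{*}=f_2-\frac f3,\quad f_3^{*}=f_3+f,\quad f_4^{*}=f_4+\overline f,\quad f_6^{*}=f_6+\overline f.$$
   Context: All functions and tensors are smooth. An almost contact metric manifold $(M,\phi,\xi,\eta,g)$ is an odd-dimensional Riemannian manifold $(M,g)$ with a $(1,1)$-tensor field $\phi$, a vector field $\xi$ and a 1-form $\eta$ with $\eta(\xi)=1$, $\phi^2X=-X+\eta(X)\xi$, $g(\phi X,\phi Y)=g(X,Y)-\eta(X)\eta(Y)$. It is a contact metric manifold if $d\eta(X,Y)=g(X,\phi Y)$, with the convention $2\,d\eta(X,Y)=X\eta(Y)-Y\eta(X)-\eta([X,Y])$. Put $h=\tfrac12 L_\xi\phi$ ($L$ the Lie derivative). The curvature is $R(X,Y)Z=\nabla_X\nabla_YZ-\nabla_Y\nabla_XZ-\nabla_{[X,Y]}Z$. The tensors $R_1,\ldots,R_6$ are $R_1(X,Y)Z=g(Y,Z)X-g(X,Z)Y$; $R_2(X,Y)Z=g(X,\phi Z)\phi Y-g(Y,\phi Z)\phi X+2g(X,\phi Y)\phi Z$; $R_3(X,Y)Z=\eta(X)\eta(Z)Y-\eta(Y)\eta(Z)X+g(X,Z)\eta(Y)\xi-g(Y,Z)\eta(X)\xi$;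 $R_4(X,Y)Z=g(Y,Z)hX-g(X,Z)hY+g(hY,Z)X-g(hX,Z)Y$; $R_5(X,Y)Z=g(hY,Z)hX-g(hX,Z)hY+g(\phi hX,Z)\phi hY-g(\phi hY,Z)\phi hX$; $R_6(X,Y)Z=\eta(X)\eta(Z)hY-\eta(Y)\eta(Z)hX+g(hX,Z)\eta(Y)\xi-g(hY,Z)\eta(X)\xi$. *)

(* Defs.v *)
From HB Require Import structures.
From mathcomp Require Import all_boot all_order all_algebra.
From mathcomp Require Import all_classical all_reals all_analysis.
From mathcomp Require Import ring.
Set Implicit Arguments.
Unset Strict Implicit.
Unset Printing Implicit Defensive.
Import Order.TTheory GRing.Theory Num.Theory.
Import numFieldNormedType.Exports.
Local Open Scope classical_set_scope.
Local Open Scope ring_scope.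

Section SmoothOn.
Context {R : realType} {V : normedModType R}.
Implicit Types (U : set V) (F G : V -> R).

(* Meant for U open; F may take arbitrary values outside U, since continuity
   and derivatives at a point only depend on the germ of F there. *)
Fixpoint Ck_on (k : nat) U F : Prop :=
  if k is k'.+1 then
    (forall x, U x -> differentiable F x) /\ (forall v, Ck_on k' U ('D_v F))
  else forall x, U x -> {for x, continuous F}.

Definition smooth_on U F := forall k, Ck_on k U F.

Lemma near_eq_differentiable F G (x : V) :
  (\near x, F x = G x) -> differentiable F x -> differentiable G x.
Proof.
move=> FG dF.
have FGx : F x = G x := nbhs_singleton FG.
have key : G \o shift x = cst (G x) + 'd F x +o_ 0 id.
  apply/eqaddoP => e e0.
  have /eqaddoP/(_ e e0) H := diff_locally dF.
  have FG0 : \forall h \near (0 : V), F (h + x) = G (h + x).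
    by move: FG; rewrite (near_shift 0 x); apply: filterS => h /=; rewrite subr0.
  apply: filterS2 H FG0 => h /=.
  rewrite !fctE /= => H FGh.
  by rewrite -FGh -FGx.
apply/diff_locallyP.
have dGF : 'd G x = 'd F x :> (V -> R).
  by apply: diff_unique key; exact: diff_continuous.
by rewrite dGF; split=> //; exact: diff_continuous.
Qed.

Lemma Ck_on_eq k U F G : open U -> (forall x, U x -> F x = G x) ->
  Ck_on k U F -> Ck_on k U G.
Proof.
move=> oU; elim: k F G => [|k IH] F G FG /=.
  move=> cF x Ux.
  have FGx : \near x, F x = G x by apply: filterS FG _; exact: open_nbhs_nbhs.
  have := cF x Ux; rewrite /prop_for /continuous_at -(FG x Ux).
  by apply: cvg_trans; exact: near_eq_cvg.
case=> dF DF; split=> [x Ux|v].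
  apply: near_eq_differentiable (dF x Ux).
  by apply: filterS FG _; exact: open_nbhs_nbhs.
apply: IH (DF v) => x Ux; apply: near_eq_derive.
by apply: filterS FG _; exact: open_nbhs_nbhs.
Qed.

Lemma Ck_onS k U F : Ck_on k.+1 U F -> Ck_on k U F.
Proof.
elim: k F => [|k IH] F [dF DF].
  by move=> x /dF; exact: differentiable_continuous.
by split=> // v; apply: IH.
Qed.

Lemma Ck_on_cst k U a : open U -> Ck_on k U (cst a).
Proof.
move=> oU; elim: k a => [|k IH] a; first by move=> x _; exact: cst_continuous.
split=> // v; apply: Ck_on_eq (IH 0) => // x _.
by rewrite derive_cst.
Qed.

Lemma Ck_onD k U F G : open U -> Ck_on k U F -> Ck_on k U G ->
  Ck_on k U (F + G).
Proof.
move=> oU; elim: k F G => [|k IH] F G.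
  by move=> cF cG x Ux; apply: continuousD; [exact: cF|exact: cG].
move=> [dF DF] [dG DG]; split=> [x Ux|v].
  by apply: differentiableD; [exact: dF|exact: dG].
apply: Ck_on_eq (IH _ _ (DF v) (DG v)) => // x Ux.
by rewrite deriveD//; apply: diff_derivable; [exact: dF|exact: dG].
Qed.

Lemma Ck_onM k U F G : open U -> Ck_on k U F -> Ck_on k U G ->
  Ck_on k U (F * G).
Proof.
move=> oU; elim: k F G => [|k IH] F G.
  by move=> cF cG x Ux; apply: continuousM; [exact: cF|exact: cG].
move=> cF cG; move: (cF) (cG) => [dF DF] [dG DG]; split=> [x Ux|v].
  by apply: differentiableM; [exact: dF|exact: dG].
have H := Ck_onD oU (IH _ _ (Ck_onS cF) (DG v)) (IH _ _ (Ck_onS cG) (DF v)).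
apply: Ck_on_eq H => // x Ux.
by rewrite deriveM//; apply: diff_derivable; [exact: dF|exact: dG].
Qed.

End SmoothOn.

Section Manifold.
Context (R : realType) (n : nat).

Structure chart (T : topologicalType) := Chart {
  chart_dom : set T;
  chart_map :> T -> 'rV[R]_n;
  chart_inv : 'rV[R]_n -> T;
  chart_dom_open : open chart_dom;
  chart_img_open : open (chart_map @` chart_dom);
  chart_mapK : forall p, chart_dom p -> chart_inv (chart_map p) = p;
  chart_map_continuous :
    forall p, chart_dom p -> {for p, continuous chart_map};
  chart_inv_continuous :
    forall x, (chart_map @` chart_dom) x -> {for x, continuous chart_inv} }.

Definition smoothly_compatible (T : topologicalType) (c d : chart T) :=
  forall i : 'I_n, smooth_on (c @` (chart_dom c `&` chart_dom d))
    (fun x => d (chart_inv c x) 0 i).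

Structure manifold := Manifold {
  mfd_space :> topologicalType;
  atlas : set (chart mfd_space);
  mfd_hausdorff : hausdorff_space mfd_space;
  mfd_second_countable : @second_countable mfd_space;
  atlas_cover : forall p : mfd_space, exists2 c, atlas c & chart_dom c p;
  atlas_compatible : forall c d, atlas c -> atlas d -> smoothly_compatible c d }.

End Manifold.

Arguments chart_dom_open {R n T} c.
Arguments chart_img_open {R n T} c.

Section SmoothFunctions.
Context {R : realType} {n : nat} (M : manifold R n).

Definition is_smooth (f : M -> R) : Prop :=
  forall c, atlas c -> smooth_on (c @` chart_dom c) (f \o chart_inv c).

Definition smooth : {pred M -> R} := [pred f | `[< is_smooth f >]].

Structure smooth_fun :=
  SmoothFun { smooth_val :> M -> R; _ : smooth_val \in smooth }.

HB.instance Definition _ := [isSub of smooth_fun for smooth_val].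
HB.instance Definition _ := [Choice of smooth_fun by <:].

Lemma is_smooth_cst a : is_smooth (cst a).
Proof. by move=> c ac k; apply: Ck_on_cst; exact: chart_img_open. Qed.

Lemma is_smoothD f g : is_smooth f -> is_smooth g -> is_smooth (f + g).
Proof.
move=> sf sg c ac k.
have := Ck_onD (chart_img_open c) (sf c ac k) (sg c ac k).
by apply: Ck_on_eq => //; exact: chart_img_open.
Qed.

Lemma is_smoothM f g : is_smooth f -> is_smooth g -> is_smooth (f * g).
Proof.
move=> sf sg c ac k.
have := Ck_onM (chart_img_open c) (sf c ac k) (sg c ac k).
by apply: Ck_on_eq => //; exact: chart_img_open.
Qed.

Lemma is_smoothZ a f : is_smooth f -> is_smooth (a *: f).
Proof. exact/is_smoothM/is_smooth_cst. Qed.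

Lemma smooth_subring_closed : subring_closed smooth.
Proof.
split=> [|f g|f g]; rewrite !inE.
- exact: is_smooth_cst.
- by move=> sf sg; apply: is_smoothD => //; rewrite -scaleN1r; exact: is_smoothZ.
- exact: is_smoothM.
Qed.

HB.instance Definition _ :=
  GRing.SubChoice_isSubComPzRing.Build (M -> R) smooth smooth_fun
    smooth_subring_closed.

Lemma smooth_subsemimod_closed : subsemimod_closed smooth.
Proof.
split=> [|a f]; last by rewrite !inE; exact: is_smoothZ.
split=> [|f g]; rewrite !inE; first exact: is_smooth_cst.
exact: is_smoothD.
Qed.

HB.instance Definition _ :=
  GRing.SubZmodule_isSubLmodule.Build R (M -> R) smooth smooth_fun
    smooth_subsemimod_closed.

Lemma smooth_funP (f g : smooth_fun) : (forall p, f p = g p) -> f = g.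
Proof. by move=> fg; apply/val_inj/funext. Qed.

Lemma smooth_funD (f g : smooth_fun) p : (f + g) p = f p + g p.
Proof. by []. Qed.
Lemma smooth_funN (f : smooth_fun) p : (- f) p = - f p.
Proof. by []. Qed.
Lemma smooth_funM (f g : smooth_fun) p : (f * g) p = f p * g p.
Proof. by []. Qed.
Lemma smooth_funZ a (f : smooth_fun) p : (a *: f) p = a * f p.
Proof. by []. Qed.
Lemma smooth_fun0 p : (0 : smooth_fun) p = 0.
Proof. by []. Qed.
Lemma smooth_fun1 p : (1 : smooth_fun) p = 1.
Proof. by []. Qed.

Definition smooth_funE := (smooth_funD, smooth_funN, smooth_funM,
  smooth_funZ, smooth_fun0, smooth_fun1).

End SmoothFunctions.


Section VectorFields.
Context {R : realType} {n : nat} (M : manifold R n).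
Local Notation C := (smooth_fun M).
Implicit Types (f g : C).

(* A vector field on M is a derivation of the R-algebra of smooth functions;
   these form a module over smooth_fun M.  Tensor fields below are maps that are
   linear over smooth_fun M in each argument. *)
Definition derivation (D : C -> C) : Prop :=
  (forall (a : R) f g, D (a *: f + g) = a *: D f + D g) /\
  (forall f g, D (f * g) = D f * g + f * D g).

Structure vfield := VField { vf_fun :> C -> C; vfP : derivation vf_fun }.
Implicit Types (X Y : vfield).

Lemma vfield_ext X Y : (forall f, X f = Y f) -> X = Y.
Proof.
case: X Y => [D dD] [E dE] /= DE.
have {}DE : D = E by apply/funext.
by rewrite DE in dD *; congr VField; exact: Prop_irrelevance.
Qed.

Lemma vfZD X a f g : X (a *: f + g) = a *: X f + X g.
Proof. exact: (vfP X).1. Qed.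

Lemma vfM X f g : X (f * g) = X f * g + f * X g.
Proof. exact: (vfP X).2. Qed.

Lemma vfD X f g : X (f + g) = X f + X g.
Proof. by have := vfZD X 1 f g; rewrite !scale1r. Qed.

Lemma vf_zero_derivation : derivation (fun=> 0).
Proof. by split=> [a f g|f g]; rewrite ?scaler0 ?mul0r ?mulr0 addr0. Qed.

Lemma vf_opp_derivation X : derivation (fun f => - X f).
Proof.
by split=> [a f g|f g]; rewrite ?vfZD ?vfM opprD ?scalerN ?mulNr ?mulrN.
Qed.

Lemma vf_add_derivation X Y : derivation (fun f => X f + Y f).
Proof.
split=> [a f g|f g]; first by rewrite !vfZD scalerDr addrACA.
by rewrite !vfM; ring.
Qed.

Lemma vf_scale_derivation (u : C) X : derivation (fun f => u * X f).
Proof.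
split=> [a f g|f g]; last by rewrite !vfM; ring.
by rewrite vfZD; apply: smooth_funP => p; rewrite !smooth_funE; ring.
Qed.

Lemma vf_bracket_derivation X Y : derivation (fun f => X (Y f) - Y (X f)).
Proof.
split=> [a f g|f g].
  by rewrite !vfZD scalerBr opprD addrACA.
by rewrite !vfM !vfD !vfM; ring.
Qed.

Definition vf_zero := VField vf_zero_derivation.
Definition vf_opp X := VField (vf_opp_derivation X).
Definition vf_add X Y := VField (vf_add_derivation X Y).
Definition vf_scale u X := VField (vf_scale_derivation u X).
Definition vf_bracket X Y := VField (vf_bracket_derivation X Y).

HB.instance Definition _ := gen_eqMixin vfield.
HB.instance Definition _ := gen_choiceMixin vfield.

Lemma vf_addA : associative vf_add.
Proof. by move=> X Y Z; apply: vfield_ext => f; exact: addrA. Qed.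

Lemma vf_addC : commutative vf_add.
Proof. by move=> X Y; apply: vfield_ext => f; exact: addrC. Qed.

Lemma vf_add0 : left_id vf_zero vf_add.
Proof. by move=> X; apply: vfield_ext => f; exact: add0r. Qed.

Lemma vf_addN : left_inverse vf_zero vf_opp vf_add.
Proof. by move=> X; apply: vfield_ext => f; exact: addNr. Qed.

HB.instance Definition _ :=
  GRing.isZmodule.Build vfield vf_addA vf_addC vf_add0 vf_addN.

Lemma vf_scaleA (u v : C) X : vf_scale u (vf_scale v X) = vf_scale (u * v) X.
Proof. by apply: vfield_ext => f; exact: mulrA. Qed.

Lemma vf_scale1 : left_id 1 vf_scale.
Proof. by move=> X; apply: vfield_ext => f; exact: mul1r. Qed.

Lemma vf_scaleDr : right_distributive vf_scale +%R.
Proof. by move=> u X Y; apply: vfield_ext => f; exact: mulrDr. Qed.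

Lemma vf_scaleDl X : {morph vf_scale^~ X : u v / u + v}.
Proof. by move=> u v; apply: vfield_ext => f; exact: mulrDl. Qed.

HB.instance Definition _ := GRing.Zmodule_isLmodule.Build C vfield
  vf_scaleA vf_scale1 vf_scaleDr vf_scaleDl.

End VectorFields.

Section Tensors.
Context {R : realType} {n : nat} (M : manifold R n).
Local Notation C := (smooth_fun M).
Local Notation VF := (vfield M).
Implicit Types (X Y Z : VF) (p : M).

(* The tangent vector X_p at p is the point derivation f |-> X f p. *)
Definition vanishes_at X p := forall f : C, X f p = 0.

(* Linearity in the second argument follows by symmetry. *)
Structure metric := Metric {
  metric_fun :> VF -> VF -> C;
  metric_sym : forall X Y, metric_fun X Y = metric_fun Y X;
  metric_linear : forall (u : C) X Y Z,
    metric_fun (u *: X + Y) Z = u * metric_fun X Z + metric_fun Y Z;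
  metric_pos : forall X p, ~ vanishes_at X p -> 0 < metric_fun X X p }.

Definition one_form := {scalar VF}.
Definition endo := {linear VF -> VF}.

(* Linearity over R in the second argument follows from lc_additive and
   lc_leibniz.  By the fundamental theorem of Riemannian geometry exactly one
   nabla satisfies these axioms for a given g. *)
Structure levi_civita (g : metric) (nabla : VF -> VF -> VF) : Prop := {
  lc_linear : forall (u : C) X Y Z,
    nabla (u *: X + Y) Z = u *: nabla X Z + nabla Y Z;
  lc_additive : forall X Y Z, nabla X (Y + Z) = nabla X Y + nabla X Z;
  lc_leibniz : forall (u : C) X Y, nabla X (u *: Y) = X u *: Y + u *: nabla X Y;
  lc_torsion_free : forall X Y, nabla X Y - nabla Y X = vf_bracket X Y;
  lc_metric : forall X Y Z, X (g Y Z) = g (nabla X Y) Z + g Y (nabla X Z) }.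

Definition curvature (nabla : VF -> VF -> VF) X Y Z : VF :=
  nabla X (nabla Y Z) - nabla Y (nabla X Z) - nabla (vf_bracket X Y) Z.

(* The convention 2 d eta(X, Y) = X eta(Y) - Y eta(X) - eta([X, Y]). *)
Definition ext_d (eta : one_form) X Y : C :=
  (2^-1 : R) *: (X (eta Y) - Y (eta X) - eta (vf_bracket X Y)).

Definition lie_endo X (phi : endo) Y : VF :=
  vf_bracket X (phi Y) - phi (vf_bracket X Y).

Structure almost_contact_metric
    (phi : endo) (xi : VF) (eta : one_form) (g : metric) : Prop := {
  acm_odd : odd n;
  acm_eta_xi : eta xi = 1;
  acm_phi2 : forall X, phi (phi X) = - X + eta X *: xi;
  acm_compatible : forall X Y, g (phi X) (phi Y) = g X Y - eta X * eta Y }.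

Structure contact_metric
    (phi : endo) (xi : VF) (eta : one_form) (g : metric) : Prop := {
  cm_acm :> almost_contact_metric phi xi eta g;
  cm_contact : forall X Y, ext_d eta X Y = g X (phi Y) }.

Section GeneralizedForm.
Variables (phi : endo) (xi : VF) (eta : one_form) (g : metric).

(* Vector fields are scaled by smooth functions, so 1/2 enters as a constant
   function. *)
Definition h_op X : VF := ((2^-1 : R) *: (1 : C)) *: lie_endo xi phi X.
Local Notation h := h_op.

Definition R1 X Y Z : VF := g Y Z *: X - g X Z *: Y.

Definition R2 X Y Z : VF :=
  g X (phi Z) *: phi Y - g Y (phi Z) *: phi X + (2 * g X (phi Y)) *: phi Z.

Definition R3 X Y Z : VF :=
  (eta X * eta Z) *: Y - (eta Y * eta Z) *: X
  + (g X Z * eta Y) *: xi - (g Y Z * eta X) *: xi.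

Definition R4 X Y Z : VF :=
  g Y Z *: h X - g X Z *: h Y + g (h Y) Z *: X - g (h X) Z *: Y.

Definition R5 X Y Z : VF :=
  g (h Y) Z *: h X - g (h X) Z *: h Y
  + g (phi (h X)) Z *: phi (h Y) - g (phi (h Y)) Z *: phi (h X).

Definition R6 X Y Z : VF :=
  (eta X * eta Z) *: h Y - (eta Y * eta Z) *: h X
  + (g (h X) Z * eta Y) *: xi - (g (h Y) Z * eta X) *: xi.

Definition sum_fR (f1 f2 f3 f4 f5 f6 : C) X Y Z : VF :=
  f1 *: R1 X Y Z + f2 *: R2 X Y Z + f3 *: R3 X Y Z
  + f4 *: R4 X Y Z + f5 *: R5 X Y Z + f6 *: R6 X Y Z.

End GeneralizedForm.
End Tensors.

(* Main.v *)
From HB Require Import structures.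
Require Import Defs.
From mathcomp Require Import all_boot all_order all_algebra.
From mathcomp Require Import all_classical all_reals all_analysis.
From mathcomp Require Import ring lra.
Set Implicit Arguments.
Unset Strict Implicit.
Unset Printing Implicit Defensive.
Import Order.TTheory GRing.Theory Num.Theory.
Import numFieldNormedType.Exports.
Local Open Scope ring_scope.

(** The difference of the two expressions is a vanishing combination
    [sum e_i R_i].  For [X] orthogonal to [xi], evaluating at [(xi, X, xi)]
    gives [(e1 - e3) X + (e4 - e6) h X = 0]; since [h] anticommutes with [phi],
    both terms vanish.  Blair's identity
    [R(xi, X) xi - phi R(xi, phi X) xi = 2 (h^2 + phi^2) X] yields
    [h^2 X = (1 - (f1 - f3)) X], so that [h X] is nonzero wherever [X] is, and
    [e1 = e3], [e4 = e6].  Evaluating at [(X, phi X, phi X)] and pairing with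
    [X] leaves only [(e1 + 3 e2) |X|^4].

    All this needs, at every point, a global vector field that is orthogonal
    to [xi] and nonzero there: cut off coordinate fields of a chart by a smooth
    bump function and project along [xi]. *)

(** * Algebra of vector fields and of the metric *)

Section MetricAlgebra.
Context {R : realType} {n : nat} (M : manifold R n) (g : metric M).
Local Notation C := (smooth_fun M).
Implicit Types (u : C) (X Y Z W : vfield M) (p : M).

Lemma scale_half2 (V : lmodType C) (X : V) :
  ((2^-1 : R) *: (1 : C)) *: (X + X) = X.
Proof.
have -> : X + X = (2%:R : C) *: X by rewrite scaler_nat mulr2n.
rewrite scalerA.
have -> : (2^-1 : R) *: (1 : C) * 2%:R = 1.
  by apply: smooth_funP => p; rewrite !smooth_funE; field.
by rewrite scale1r.
Qed.

(** Cancels a factor 2, both for functions and for vector fields: the scalars are smooth functions,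
    so halving is scaling by a constant function. *)
Lemma double_inj (V : lmodType C) : injective (fun X : V => X + X).
Proof. by move=> X Y /= XY; rewrite -(scale_half2 X) XY scale_half2. Qed.

Lemma metricDl X Y Z : g (X + Y) Z = g X Z + g Y Z.
Proof. by rewrite -[X in X + Y]scale1r metric_linear mul1r. Qed.

Lemma metric0l Z : g 0 Z = 0.
Proof. by apply: (addrI (g 0 Z)); rewrite -metricDl !addr0. Qed.

Lemma metricZl u X Z : g (u *: X) Z = u * g X Z.
Proof. by rewrite -[u *: X]addr0 metric_linear metric0l addr0. Qed.

Lemma metricNl X Z : g (- X) Z = - g X Z.
Proof. by rewrite -scaleN1r metricZl mulN1r. Qed.

Lemma metricDr X Y Z : g Z (X + Y) = g Z X + g Z Y.
Proof. by rewrite !(Defs.metric_sym g Z) metricDl. Qed.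

Lemma metricZr u X Z : g Z (u *: X) = u * g Z X.
Proof. by rewrite !(Defs.metric_sym g Z) metricZl. Qed.

Lemma metricNr X Z : g Z (- X) = - g Z X.
Proof. by rewrite !(Defs.metric_sym g Z) metricNl. Qed.

Lemma metric0r Z : g Z 0 = 0.
Proof. by rewrite Defs.metric_sym metric0l. Qed.

Definition metricE := (metricDl, metricDr, metricNl, metricNr, metricZl,
  metricZr, metric0l, metric0r).

(** The difference [W] satisfies [g W W = 0], and positivity of [g] then makes it vanish at every
    point. *)
Lemma metric_nondeg X Y : (forall Z, g X Z = g Y Z) -> X = Y.
Proof.
move=> XY; apply/subr0_eq; set W := X - Y.
have gW : g W W = 0 by rewrite /W metricDl metricNl XY subrr.
apply: vfield_ext => f; apply: smooth_funP => p; rewrite smooth_fun0.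
apply: contrapT => Wfp.
have /(Defs.metric_pos g) : ~ vanishes_at W p by move/(_ f).
by rewrite gW smooth_fun0 ltxx.
Qed.

Lemma vf0 X : X 0 = 0.
Proof. by apply: (addrI (X 0)); rewrite -vfD !addr0. Qed.

Lemma vfN X u : X (- u) = - X u.
Proof. by apply: (addrI (X u)); rewrite -vfD !subrr vf0. Qed.

Lemma vfB X u v : X (u - v) = X u - X v.
Proof. by rewrite vfD vfN. Qed.

Lemma vf1 X : X 1 = 0.
Proof.
by have := vfM X 1 1; rewrite !mulr1 mul1r => /(congr1 (fun z => z - X 1));
  rewrite subrr addrK => <-.
Qed.

Lemma vf_actD X Y u : (X + Y) u = X u + Y u. Proof. by []. Qed.
Lemma vf_actN X u : (- X) u = - X u. Proof. by []. Qed.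
Lemma vf_actZ u X v : (u *: X) v = u * X v. Proof. by []. Qed.
Lemma vf_act0 u : (0 : vfield M) u = 0. Proof. by []. Qed.
Definition vf_actE := (vf_actD, vf_actN, vf_actZ, vf_act0).

Lemma vf_bracketE X Y u : vf_bracket X Y u = X (Y u) - Y (X u).
Proof. by []. Qed.

Lemma vf_jacobi X Y Z : vf_bracket X (vf_bracket Y Z) =
  vf_bracket (vf_bracket X Y) Z + vf_bracket Y (vf_bracket X Z).
Proof.
by apply: vfield_ext => f; rewrite vf_actD !vf_bracketE !vfB; ring.
Qed.

End MetricAlgebra.

Ltac vf_ring := apply: vfield_ext => ?; rewrite !vf_actE; ring.

(** Reduces a goal to a known equation: what remains is an identity between the differences of the
    sides, left to [ring] or [vf_ring]. *)
Lemma eq_by_sub (V : zmodType) (a b c d : V) : a = b -> c - d = a - b -> c = d.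
Proof. by move=> ->; rewrite subrr => /subr0_eq. Qed.

(* The symmetric part of X |-> nabla X xi on a contact metric manifold; the
   skew part is - phi. *)
HB.lock Definition shape (R : realType) n (M : manifold R n) (phi : endo M)
  (xi : vfield M) (nabla : vfield M -> vfield M -> vfield M) X :=
  nabla X xi + phi X.

(** * Almost contact and contact metric identities *)

Section ContactMetric.
Context {R : realType} {n : nat} (M : manifold R n).
Variables (phi : endo M) (xi : vfield M) (eta : one_form M) (g : metric M).
Variable nabla : vfield M -> vfield M -> vfield M.
Hypothesis cm : contact_metric phi xi eta g.
Hypothesis lc : levi_civita g nabla.
Local Notation C := (smooth_fun M).
Implicit Types (u : C) (X Y Z W : vfield M) (p : M).
Local Notation h := (h_op phi xi).
Local Notation br := (@vf_bracket R n M).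

Let eta_xi : eta xi = 1 := acm_eta_xi cm.
Let phi2 X : phi (phi X) = - X + eta X *: xi := acm_phi2 cm X.

Let etaZ u X : eta (u *: X) = u * eta X.
Proof. by rewrite linearZ. Qed.

Let phiZ u X : phi (u *: X) = u *: phi X.
Proof. by rewrite linearZ. Qed.

Let etaD X Y : eta (X + Y) = eta X + eta Y.
Proof. by rewrite linearD. Qed.

Let etaN X : eta (- X) = - eta X.
Proof. by rewrite linearN. Qed.

Let phiD X Y : phi (X + Y) = phi X + phi Y.
Proof. by rewrite linearD. Qed.

Let phiN X : phi (- X) = - phi X.
Proof. by rewrite linearN. Qed.

(** Since [phi (phi xi) = 0], applying [phi2] to [phi xi] gives [phi xi = c *: xi]. Then
    [c * c = eta (phi (phi xi)) = 0], and a function with zero square is zero at each point. *)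
Lemma phi_xi : phi xi = 0.
Proof.
have phiphixi : phi (phi xi) = 0 by rewrite phi2 eta_xi scale1r addNr.
set c := eta (phi xi).
have phixi : phi xi = c *: xi.
  have := phi2 (phi xi).
  by rewrite phiphixi linear0 addrC => /esym/subr0_eq/esym.
have c0 : c = 0.
  have : c * c = 0.
    rewrite -[c * c]mulr1 -eta_xi -etaZ -scalerA -phixi.
    by rewrite -phiZ -phixi phiphixi linear0.
  move=> cc; apply: smooth_funP => p.
  have /eqP : c p * c p = 0 by rewrite -smooth_funM cc smooth_fun0.
  by rewrite mulf_eq0 orbb => /eqP ->.
by rewrite phixi c0 scale0r.
Qed.

(** Compare the two ways of expanding the cube of [phi]. *)
Lemma eta_phi X : eta (phi X) = 0.
Proof.
have : phi (phi (phi X)) = - phi X + eta (phi X) *: xi by exact: phi2.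
rewrite (phi2 X) linearD linearN phiZ phi_xi scaler0 addr0 -{1}[- _]addr0.
by move/addrI/(congr1 eta); rewrite linear0 etaZ eta_xi mulr1.
Qed.

Lemma metric_xi X : g X xi = eta X.
Proof.
have := acm_compatible cm X xi.
by rewrite phi_xi metric0r eta_xi mulr1 => /esym/subr0_eq.
Qed.

Lemma phi_skew X Y : g (phi X) Y = - g X (phi Y).
Proof.
have := acm_compatible cm X (phi Y).
rewrite eta_phi mulr0 subr0 => <-.
by rewrite phi2 !metricE metric_xi eta_phi mulr0 addr0 opprK.
Qed.

(** * Invariance of the contact structure along [xi] *)

Lemma ext_d2 X Y :
  X (eta Y) - Y (eta X) - eta (br X Y) = g X (phi Y) + g X (phi Y).
Proof.
rewrite -(cm_contact cm) /ext_d; apply: smooth_funP => p.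
by rewrite !smooth_funE; field.
Qed.

Lemma lie_eta X : xi (eta X) = eta (br xi X).
Proof.
have := ext_d2 xi X; rewrite eta_xi vf1 subr0.
rewrite (Defs.metric_sym g) metric_xi eta_phi addr0.
exact: subr0_eq.
Qed.

(** The Lie derivative of [eta] along [xi] is zero by [lie_eta], hence so is that of its exterior
    derivative; the Jacobi identity makes this explicit. *)
Lemma lie_fundamental X Y :
  xi (g X (phi Y)) = g (br xi X) (phi Y) + g X (phi (br xi Y)).
Proof.
apply: (@double_inj R n M C^o) => /=.
rewrite -vfD addrACA -!ext_d2 !vfB !lie_eta (vf_jacobi xi X Y) linearD /=.
by rewrite -(lie_eta X) -(lie_eta Y); ring.
Qed.

(** * The covariant derivative of [xi] and its symmetric part *)

Lemma nablaNr X Y : nabla X (- Y) = - nabla X Y.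
Proof.
have n0 : nabla X 0 = 0.
  by apply: (addrI (nabla X 0)); rewrite -(lc_additive lc) !addr0.
by apply: (addrI (nabla X Y)); rewrite -(lc_additive lc) !subrr.
Qed.

Lemma nablaZl u X Y : nabla (u *: X) Y = u *: nabla X Y.
Proof.
have n0 : nabla 0 Y = 0.
  apply: (addrI (1 *: nabla 0 Y)).
  by rewrite -(lc_linear lc) addr0 scaler0 addr0 scale1r.
by rewrite -[u *: X]addr0 (lc_linear lc) n0 addr0.
Qed.

Lemma nablaDl X Y Z : nabla (X + Y) Z = nabla X Z + nabla Y Z.
Proof. by have := lc_linear lc 1 X Y Z; rewrite !scale1r. Qed.

Local Notation S := (shape phi xi nabla).

Lemma nabla_xiE X : nabla X xi = S X - phi X.
Proof. by rewrite shape.unlock addrK. Qed.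

Lemma bracketE X Y : br X Y = nabla X Y - nabla Y X.
Proof. by rewrite (lc_torsion_free lc). Qed.

(** Without torsion, twice the exterior derivative of [eta] is the skew part of the covariant
    derivative of [xi]. *)
Lemma nabla_xi_skew X Y :
  g (nabla X xi) Y - g (nabla Y xi) X = g X (phi Y) + g X (phi Y).
Proof.
rewrite -ext_d2 -!metric_xi !(lc_metric lc) bracketE !metricE.
rewrite (Defs.metric_sym g Y (nabla _ _)) (Defs.metric_sym g X (nabla _ _)).
ring.
Qed.

Lemma shape_sym X Y : g (S X) Y = g X (S Y).
Proof.
have := nabla_xi_skew X Y.
rewrite !nabla_xiE (Defs.metric_sym g X (S Y)) !metricE.
rewrite !phi_skew (Defs.metric_sym g Y (phi X)) phi_skew => H.
by apply: (eq_by_sub H); ring.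
Qed.

Lemma metric_nabla_xi_xi X : g (nabla X xi) xi = 0.
Proof.
have := lc_metric lc X xi xi; rewrite metric_xi eta_xi vf1.
rewrite (Defs.metric_sym g xi) => /esym H.
by apply: (@double_inj R n M C^o); rewrite addr0.
Qed.

(** Integral curves of [xi] are geodesics: put [xi] into [nabla_xi_skew], where [xi] has constant
    length and is orthogonal to the image of [phi]. *)
Lemma nabla_xi_xi : nabla xi xi = 0.
Proof.
apply: (metric_nondeg (g := g)) => Z; have := nabla_xi_skew xi Z.
rewrite metric_nabla_xi_xi subr0 (Defs.metric_sym g xi) metric_xi eta_phi addr0.
by rewrite metric0l.
Qed.

Lemma shape_xi : S xi = 0.
Proof. by rewrite shape.unlock nabla_xi_xi phi_xi addr0. Qed.

Lemma eta_shape X : eta (S X) = 0.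
Proof. by rewrite -metric_xi shape_sym shape_xi metric0r. Qed.

Lemma shapeZ u X : S (u *: X) = u *: S X.
Proof. by rewrite shape.unlock nablaZl linearZ scalerDr. Qed.

Lemma shapeD X Y : S (X + Y) = S X + S Y.
Proof. by rewrite shape.unlock nablaDl linearD addrACA. Qed.

Lemma shapeN X : S (- X) = - S X.
Proof. by rewrite -scaleN1r shapeZ scaleN1r. Qed.

(** This is [lie_fundamental] with the brackets expressed by [nabla]. Both sides are shown to vanish
    later, once [S] is known to anticommute with [phi]. *)
Lemma nabla_xi_phi_shape Y :
  nabla xi (phi Y) - phi (nabla xi Y) = - (S (phi Y) + phi (S Y)).
Proof.
apply: (metric_nondeg (g := g)) => X; rewrite !(Defs.metric_sym g _ X).
have := lie_fundamental X Y.
rewrite (lc_metric lc) !bracketE !nabla_xiE !(linearB phi) /= phi2 !metricE.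
rewrite !phi_skew phi2 !metricE. rewrite -(shape_sym X (phi Y)) => H.
apply: (eq_by_sub H);
by rewrite !metric_xi; ring.
Qed.

(** As [S] anticommutes with [phi], this amounts to the classical formula nabla_X xi = - phi X - phi
    h X. Properties of [h] are read off from those of [S]. *)
Lemma h_shape Y : h Y = - S (phi Y).
Proof.
rewrite /h_op /lie_endo !bracketE !nabla_xiE !(linearB phi) /=.
have -> : nabla xi (phi Y) - (S (phi Y) - phi (phi Y)) -
     (phi (nabla xi Y) - (phi (S Y) - phi (phi Y))) =
     (nabla xi (phi Y) - phi (nabla xi Y)) - S (phi Y) + phi (S Y).
  vf_ring.
rewrite nabla_xi_phi_shape.
have -> : - (S (phi Y) + phi (S Y)) - S (phi Y) + phi (S Y) =
   - S (phi Y) + - S (phi Y) by vf_ring.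
exact: scale_half2.
Qed.

Lemma nabla_xiZ u Y : nabla xi (u *: Y) = xi u *: Y + u *: nabla xi Y.
Proof. exact: (lc_leibniz lc). Qed.

Lemma eta_nabla_xi Y : eta (nabla xi Y) = xi (eta Y).
Proof.
by rewrite -!metric_xi (lc_metric lc) nabla_xi_xi metric0r addr0.
Qed.

(* Differentiating phi^2 = - id + eta (x) xi along xi. *)
Lemma shape_phi_phi Y : S Y = phi (S (phi Y)).
Proof.
pose B Y := nabla xi (phi Y) - phi (nabla xi Y).
have B0 : B (phi Y) + phi (B Y) = 0.
  rewrite /B linearB /= addrA subrK !phi2 (lc_additive lc) nabla_xiZ.
  rewrite nabla_xi_xi scaler0 addr0 eta_nabla_xi nablaNr.
  by rewrite opprD opprK addrACA addNr subrr add0r.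
move: B0; rewrite /B !nabla_xi_phi_shape linearN linearD /= (linearD phi) /=.
rewrite !phi2 shapeD shapeN shapeZ shape_xi eta_shape scaler0 scale0r !addr0 => H.
apply/esym/subr0_eq/(@double_inj R n M (vfield M)) => /=; rewrite addr0.
rewrite -oppr0 -H; vf_ring.
Qed.

Lemma shape_phi Y : S (phi Y) = - phi (S Y).
Proof.
by rewrite (shape_phi_phi Y) phi2 eta_shape scale0r addr0 opprK.
Qed.

Lemma h_phi Y : h (phi Y) = - phi (h Y).
Proof.
rewrite !h_shape linearN /= -shape_phi_phi phi2 shapeD shapeN shapeZ.
by rewrite shape_xi scaler0 addr0 !opprK.
Qed.

Lemma hZ u X : h (u *: X) = u *: h X.
Proof. by rewrite !h_shape phiZ shapeZ scalerN. Qed.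

Lemma h_xi : h xi = 0.
Proof. by rewrite h_shape phi_xi -(scale0r xi) shapeZ !scale0r oppr0. Qed.

Lemma h0 : h 0 = 0.
Proof. by have := hZ 0 xi; rewrite !scale0r. Qed.

Lemma eta_h X : eta (h X) = 0.
Proof. by rewrite h_shape linearN /= eta_shape oppr0. Qed.

Lemma h_h X : h (h X) = S (S X).
Proof.
rewrite (h_shape (h X)) (h_shape X) (shape_phi X) opprK phi2 eta_shape scale0r.
by rewrite addr0 shapeN opprK.
Qed.

Lemma nabla_xi_phi Y : nabla xi (phi Y) = phi (nabla xi Y).
Proof.
by apply/subr0_eq; rewrite nabla_xi_phi_shape shape_phi addNr oppr0.
Qed.

(** * Evaluations of the curvature and of the tensors [R1] to [R6] *)

Lemma curvature_xi X : curvature nabla xi X xi =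
  nabla xi (S X) - S (nabla xi X) + S (S X) + phi (phi X).
Proof.
rewrite /curvature bracketE nabla_xi_xi !nabla_xiE.
have -> : nabla X 0 = 0.
  have := nablaNr X 0; rewrite oppr0 => H.
  by apply: (@double_inj R n M (vfield M)); rewrite {1}H addr0 addNr.
rewrite (lc_additive lc) nablaNr nabla_xi_phi !(shapeD, shapeN).
rewrite !(phiD, phiN) shape_phi.
vf_ring.
Qed.

(* Blair's identity for the Jacobi operator of xi. *)
Lemma curvature_xi_phi X :
  curvature nabla xi X xi - phi (curvature nabla xi (phi X) xi) =
  (h (h X) + phi (phi X)) + (h (h X) + phi (phi X)).
Proof.
rewrite !curvature_xi h_h nabla_xi_phi !shape_phi !(shapeN, nablaNr).
rewrite !shape_phi nabla_xi_phi.
rewrite !(phiD, phiN) !phi2 !(eta_phi, eta_shape, eta_nabla_xi, vf0).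
rewrite !scale0r etaD etaN etaZ eta_xi.
vf_ring.
Qed.

(** [R2] and [R5] vanish here because [phi] and [h] annihilate [xi]. *)
Lemma sum_fR_xi f1 f2 f3 f4 f5 f6 X : eta X = 0 ->
  sum_fR phi xi eta g f1 f2 f3 f4 f5 f6 xi X xi =
  (f3 - f1) *: X + (f6 - f4) *: h X.
Proof.
move=> X0; rewrite /sum_fR /R1 /R2 /R3 /R4 /R5 /R6 !h_xi !phi_xi.
rewrite linear0 !(metric0l, metric0r) (Defs.metric_sym g xi) !metric_xi.
rewrite !eta_phi eta_h X0 eta_xi !(scale0r, scaler0).
vf_ring.
Qed.

Lemma metric_phi X : g X (phi X) = 0.
Proof.
by apply: (@double_inj R n M C^o); rewrite addr0 -{1}[g X _]opprK -phi_skew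
  (Defs.metric_sym g (phi X)) addNr.
Qed.

(** [R1] contributes [f1] and [R2] contributes [3 f2]. Every term of [R3] and [R6] has a factor
    [eta X] or [eta (phi X)], and the terms of [R4] and of [R5] cancel because [h] anticommutes with
    [phi]. *)
Lemma sum_fR_phi f1 f2 f3 f4 f5 f6 X : eta X = 0 ->
  g (sum_fR phi xi eta g f1 f2 f3 f4 f5 f6 X (phi X) (phi X)) X =
  (f1 + 3%:R * f2) * (g X X * g X X).
Proof.
move=> X0; rewrite /sum_fR /R1 /R2 /R3 /R4 /R5 /R6 !eta_phi X0.
rewrite !phi2 X0 !scale0r !addr0 h_phi phiN !phi2.
(* With [h (phi X)] rewritten, the cancellation holds for any field [H] orthogonal to [xi] in place
   of [h X]. *)
move: (h X) (eta_h X) => H H0.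
rewrite !metricE !phi_skew !phi2 H0 X0 !scale0r !addr0.
rewrite !metricE metric_phi.
ring.
Qed.

(** * Comparison of the two expressions of the curvature *)

Section Uniqueness.
Variables (f1 f2 f3 f4 f5 f6 s1 s2 s3 s4 s5 s6 : C).
Hypothesis Rf : forall X Y Z,
  curvature nabla X Y Z = sum_fR phi xi eta g f1 f2 f3 f4 f5 f6 X Y Z.
Hypothesis Rs : forall X Y Z,
  curvature nabla X Y Z = sum_fR phi xi eta g s1 s2 s3 s4 s5 s6 X Y Z.

(** Substitute [sum_fR_xi] into Blair's identity; the terms in [h X] cancel by anticommutation. *)
Lemma h_h_perp X : eta X = 0 -> h (h X) = (1 - (f1 - f3)) *: X.
Proof.
move=> X0; have := curvature_xi_phi X.
rewrite !Rf !sum_fR_xi ?eta_phi // phi2 X0 scale0r addr0 h_phi.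
rewrite phiD 2!phiZ phi2 phiN phi2 eta_h X0 !scale0r !addr0 => H.
apply: (@double_inj R n M (vfield M)); apply: (eq_by_sub (esym H)).
vf_ring.
Qed.

Lemma sum_fR_coef_perp X (A := s1 - s3 - (f1 - f3)) (B := s4 - s6 - (f4 - f6)) :
  eta X = 0 ->
  A *: X = 0 /\ (B * (1 - (f1 - f3))) *: X = 0.
Proof.
have AB Y : eta Y = 0 -> A *: Y + B *: h Y = 0.
  move=> Y0; have := sum_fR_xi s1 s2 s3 s4 s5 s6 Y0.
  rewrite -Rs Rf sum_fR_xi // => H.
  apply: (eq_by_sub H); rewrite /A /B; vf_ring.
move=> X0.
(* Apply [phi] to the relation for [X] and add the relation for [phi X]: the terms in [h] have
   opposite signs, leaving twice [A *: phi X]. *)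
have AphiX : A *: phi X = 0.
  have := AB _ (eta_phi X); have := congr1 phi (AB _ X0).
  rewrite phiD 2!phiZ linear0 h_phi => H1 H2.
  apply: (@double_inj R n M (vfield M)).
  by rewrite addr0 -[RHS]addr0 -{1}H1 -H2; vf_ring.
have AX : A *: X = 0.
  have := congr1 phi AphiX; rewrite linear0 phiZ phi2 X0 scale0r addr0.
  by rewrite scalerN => /(congr1 -%R); rewrite opprK oppr0.
split=> //; have := AB _ X0; rewrite AX add0r => /(congr1 h).
by rewrite h0 hZ h_h_perp // scalerA.
Qed.

Lemma generalized_form_unique :
  (forall p, f1 p - f3 p < 1) ->
  (forall p, exists2 X, eta X = 0 & 0 < g X X p) ->
  [/\ s1 - f1 = s3 - f3, s4 - f4 = s6 - f6 & s1 - f1 = - (3%:R * (s2 - f2))].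
Proof.
move=> f13 ex; split; apply: smooth_funP => p; have [X X0 Xp] := ex p.
- have [/(congr1 (fun Y => g Y X p)) + _] := sum_fR_coef_perp X0.
  rewrite metricZl metric0l smooth_funM smooth_fun0 => /eqP.
  rewrite mulf_eq0 (gt_eqF Xp) orbF !smooth_funE => /eqP; lra.
- have [_ /(congr1 (fun Y => g Y X p))] := sum_fR_coef_perp X0.
  rewrite metricZl metric0l !smooth_funM smooth_fun0 => /eqP.
  rewrite !mulf_eq0 (gt_eqF Xp) orbF !smooth_funE.
  (* Of the two factors, [1 - (f1 - f3)] is positive at [p] by [f13], so the other one vanishes. *)
  by have := f13 p => + /orP[] /eqP; lra.
- have := sum_fR_phi s1 s2 s3 s4 s5 s6 X0.
  rewrite -Rs Rf sum_fR_phi // => /(congr1 (fun u : C => u p)).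
  rewrite !(smooth_funM _ (g X X * _)) smooth_funM.
  have /mulIf H : g X X p * g X X p != 0 by rewrite mulf_neq0 ?gt_eqF.
  move=> /H; rewrite !smooth_funE.
  lra.
Qed.

End Uniqueness.

End ContactMetric.

Local Open Scope classical_set_scope.

(** * Smooth functions on open sets: locality and composition *)

Section SmoothCalculus.
Context {R : realType} {V : normedModType R}.
Implicit Types (U W : set V) (F G : V -> R) (k : nat).

(** Allows a different formula for [F] around each point, as needed for functions extended by
    zero. *)
Lemma Ck_on_local k U F :
  (forall x, U x -> exists2 W, W x & Ck_on k W F) -> Ck_on k U F.
Proof.
elim: k F => [|k IH] F UF.
  by move=> x /UF[W Wx]; exact.
split=> [x /UF[W Wx [dF _]]|v]; first exact: dF.
by apply: IH => x /UF[W Wx [_ /(_ v)]]; exists W.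
Qed.

Lemma Ck_on_sum k n U (F : 'I_n -> V -> R) : open U ->
  (forall i, Ck_on k U (F i)) -> Ck_on k U (\sum_i F i).
Proof.
move=> oU FU; elim/big_ind: _ => // [|G H GU HU].
  exact: (Ck_on_cst k 0 oU).
exact: Ck_onD.
Qed.

Lemma smooth_on_derive U F v : smooth_on U F -> smooth_on U ('D_v F).
Proof. by move=> sF k; exact: (sF k.+1).2. Qed.

Lemma smooth_on_differentiable U F x :
  smooth_on U F -> U x -> differentiable F x.
Proof. by move=> sF Ux; exact: (sF 1%N).1. Qed.

Lemma smooth_onM U F G : open U ->
  smooth_on U F -> smooth_on U G -> smooth_on U (F * G).
Proof. by move=> oU sF sG k; exact: Ck_onM. Qed.

Lemma smooth_onD U F G : open U ->
  smooth_on U F -> smooth_on U G -> smooth_on U (F + G).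
Proof. by move=> oU sF sG k; exact: Ck_onD. Qed.

Lemma smooth_onN U F : open U -> smooth_on U F -> smooth_on U (- F).
Proof.
move=> oU sF; rewrite -mulN1r; apply: smooth_onM => // k.
exact: (Ck_on_cst k (-1) oU).
Qed.

Section Composition.
Context {n : nat}.
Variables (U : set V) (T : V -> 'rV[R]_n).
Hypotheses (oU : open U) (sT : forall j, smooth_on U (fun x => T x 0 j)).

Let TE : T = \sum_j (fun x => T x 0 j *: delta_mx 0 j).
Proof.
by apply/funext => x; rewrite fct_sumE [LHS]row_sum_delta.
Qed.

Lemma differentiable_row x : U x -> differentiable T x.
Proof.
move=> Ux; rewrite TE; apply: differentiable_sum => j.
by apply: differentiableZl; exact: smooth_on_differentiable (sT j) Ux.
Qed.

Lemma derive_comp_row (F : 'rV[R]_n -> R) x v : U x ->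
  differentiable F (T x) ->
  'D_v (F \o T) x =
  \sum_j 'D_v (fun x => T x 0 j) x * 'D_(delta_mx 0 j) F (T x).
Proof.
move=> Ux dF; have dT := differentiable_row Ux.
rewrite deriveE; last exact: differentiable_comp.
rewrite diff_comp //=.
have -> : 'd T x v = \sum_j 'D_v (fun x => T x 0 j) x *: delta_mx 0 j.
  rewrite -deriveE // derive_mx; last exact: diff_derivable.
  rewrite [LHS]row_sum_delta; apply: eq_bigr => j _.
  by rewrite mxE.
rewrite linear_sum; apply: eq_bigr => j _.
by rewrite linearZ -(deriveE _ dF). 
Qed.

(** Induction on [k]: by the chain rule a directional derivative is a sum of products of a smooth
    function with a composition of lower order. *)
Lemma Ck_on_comp_row k (U' : set 'rV[R]_n) (F : 'rV[R]_n -> R) :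
  (forall x, U x -> U' (T x)) -> Ck_on k U' F -> Ck_on k U (F \o T).
Proof.
move=> UU'; elim: k F => [|k IH] F.
  move=> cF x Ux; apply: continuous_comp; last exact/cF/UU'.
  exact/differentiable_continuous/differentiable_row.
move=> [dF DF]; split=> [x Ux|v].
  by apply: differentiable_comp; [exact: differentiable_row|exact/dF/UU'].
pose G := \sum_j 'D_v (fun x => T x 0 j) * ('D_(delta_mx 0 j) F \o T).
apply: (@Ck_on_eq _ _ _ _ G) => // [x Ux|].
  rewrite derive_comp_row //; last exact/dF/UU'.
  by rewrite /G fct_sumE.
apply: Ck_on_sum => // j; apply: Ck_onM => //; last exact: IH (DF _).
exact: (smooth_on_derive v (sT j)) k.
Qed.

End Composition.
End SmoothCalculus.

(** * A smooth function on the line that vanishes on the negative half *)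

Section FlatFunction.
Context {R : realType}.
Implicit Types (t : R).

(* t^-m exp(-1/t), extended by 0; a family closed under differentiation up to
   linear combinations. *)
Definition flat m t : R := if 0 < t then t ^- m * expR (- t^-1) else 0.

Lemma flat_gt0 m t : 0 < t -> 0 < flat m t.
Proof.
by move=> t0; rewrite /flat t0 mulr_gt0 ?expR_gt0// invr_gt0 exprn_gt0.
Qed.

Lemma flat_ge0 m t : 0 <= flat m t.
Proof.
by have [/flat_gt0/ltW//|t0] := ltP 0 t; rewrite /flat ltNge t0.
Qed.

(** From exp(x) >= 1 + x^(m+2) / (m+2)! at x = 1/t. The quadratic bound gives derivative zero at the
    origin. *)
Lemma flat_le m t : flat m t <= (m.+2)`!%:R * t ^+ 2.
Proof.
rewrite /flat; case: ifPn => [t0|_]; last by rewrite mulr_ge0 ?sqr_ge0.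
have ti0 : 0 <= t^-1 by rewrite invr_ge0 ltW.
have f0 : (m.+2)`!%:R != 0 :> R by rewrite pnatr_eq0 -lt0n fact_gt0.
have tn0 : t != 0 by rewrite gt_eqF.
rewrite expRN ler_pdivrMr ?expR_gt0 //.
apply: le_trans (ler_wpM2l _ (expR_ge1Dxn m.+1 ti0)); last first.
  by rewrite mulr_ge0 ?sqr_ge0.
have -> : (m.+2)`!%:R * t ^+ 2 * (1 + t^-1 ^+ m.+2 / (m.+2)`!%:R) =
    (m.+2)`!%:R * t ^+ 2 + t ^- m.
  have tm : t ^+ m != 0 by rewrite expf_neq0.
  by rewrite exprVn !exprS; field; rewrite f0 tn0 tm.
by rewrite lerDr mulr_ge0 ?sqr_ge0.
Qed.

Lemma is_derive_flat m t :
  is_derive t 1 (flat m) (flat m.+2 t - m%:R * flat m.+1 t).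
Proof.
have [t0|t0|->] := ltgtP t 0.
- rewrite /flat ltNge (ltW t0) /= mulr0 subr0.
  apply: (@near_eq_is_derive _ _ _ (cst 0)).
  near=> s; have s0 : s < 0 by near: s; exact: lt_nbhsl.
  by rewrite /flat ltNge (ltW s0).
- have tn0 : t != 0 by rewrite gt_eqF.
  have dV : is_derive t 1 (@GRing.inv R) (- t ^- 2).
    apply: is_derive_eq (is_deriveV tn0 (is_derive_id t 1)) _.
    by rewrite scaler1.
  have dE : is_derive t 1 (expR \o (- @GRing.inv R)) (t ^- 2 * expR (- t^-1)).
    by apply: is_derive_eq; rewrite opprK mulrC.
  apply: (@near_eq_is_derive _ _ _ (GRing.inv ^+ m * (expR \o - GRing.inv))).
    near=> s; have s0 : 0 < s by near: s; exact: lt_nbhsr.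
    by rewrite /flat s0 !fctE exprVn.
  apply: is_derive_eq (is_deriveM (is_deriveX m dV) dE) _.
  rewrite !fctE /flat t0 exprVn /GRing.scale /=.
  case: m => [|m]; rewrite ?expr0 ?exprVn ?exprS.
    by field.
  have tm : t ^+ m != 0 by rewrite expf_neq0.
  by rewrite -pred_Sn; field; rewrite tn0 tm.
- rewrite /flat ltxx mulr0 subr0.
  have H : h^-1 *: ((flat m \o shift 0) (h *: 1) - flat m 0) @[h --> 0^']
      --> (0 : R).
    apply/cvgrPdist_le => e e0; pose C : R := (m.+2)`!%:R.
    have C0 : 0 < C by rewrite ltr0n fact_gt0.
    near=> h; rewrite /= sub0r normrN addr0 scaler1 {2}/flat ltxx subr0.
    have h0 : h != 0 by near: h; exact: nbhs_dnbhs_neq.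
    (* By [flat_le] the difference quotient is at most [C] times the absolute value of [h]. *)
    have hC : `|h| <= e / C by near: h; apply: dnbhs0_le; rewrite divr_gt0.
    rewrite normrM normfV ler_pdivrMl ?normr_gt0 // ger0_norm ?flat_ge0 //.
    apply: le_trans (flat_le m h) _.
    rewrite -(real_normK (num_real h)) expr2 mulrCA -/C.
    by rewrite ler_wpM2l // -ler_pdivlMl // mulrC.
  by apply: DeriveDef; [apply/cvg_ex; exists 0|exact: cvg_lim].
Unshelve. all: by end_near.
Qed.

(** Induction on [k] for all [m] at once, since differentiating raises the index. *)
Lemma Ck_on_flat {V : normedModType R} k m (U : set V) (q : V -> R) : open U ->
  smooth_on U q -> Ck_on k U (flat m \o q).
Proof.
move=> oU sq; have df n t : differentiable (flat n) t.
  by apply/derivable1_diffP; have [] := is_derive_flat n t.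
have dq x : U x -> differentiable q x by exact: smooth_on_differentiable.
elim: k m => [|k IH] m.
  move=> x Ux; apply: continuous_comp.
    exact/differentiable_continuous/dq.
  exact/differentiable_continuous/df.
split=> [x Ux|v]; first by apply: differentiable_comp => //; exact: dq.
apply: (@Ck_on_eq _ _ _ _ ('D_v q *
   ((flat m.+2 \o q) + cst (- m%:R) * (flat m.+1 \o q)))) => // [x Ux|].
  rewrite [RHS]deriveE; last by apply: differentiable_comp => //; exact: dq.
  rewrite diff_comp //=; last exact: dq.
  rewrite deriv1E; last by apply/derivable1_diffP.
  rewrite derive1E (@derive_val _ _ _ _ _ _ _ (is_derive_flat m (q x))).
  rewrite -deriveE; last exact: dq.
  by rewrite /= -mulNr.
apply: Ck_onM => //; first exact: smooth_on_derive.
by apply: Ck_onD => //; apply: Ck_onM => //; exact: Ck_on_cst.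
Qed.

End FlatFunction.

(** * Bump functions in coordinate space *)

Section Bump.
Context {R : realType} {n : nat}.
Implicit Types (U : set 'rV[R]_n) (a x : 'rV[R]_n) (r : R).

Lemma derive_coord (i : 'I_n) x v : 'D_v (fun y : 'rV[R]_n => y 0 i) x = v 0 i.
Proof.
have did : derivable (@id 'rV[R]_n) x v by exact: derivable_id.
have := derive_mx did; rewrite derive_id => /matrixP/(_ 0 i).
by rewrite mxE => <-.
Qed.

Lemma smooth_on_coord (i : 'I_n) U : open U -> smooth_on U (fun y => y 0 i).
Proof.
move=> oU [|k]; first by move=> x _; exact: coord_continuous.
split=> [x _|v]; first exact: differentiable_coord.
apply: (@Ck_on_eq _ _ _ _ (cst (v 0 i))) => // [x _|]; last exact: Ck_on_cst.
by rewrite derive_coord.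
Qed.

Lemma smooth_on_cst U (c : R) : open U -> smooth_on U (cst c).
Proof. by move=> oU k; exact: Ck_on_cst. Qed.

(** Positive exactly on the open Euclidean ball of radius [r] about [a] when [r] is positive. *)
Definition bump a r x : R := flat 0 (r ^+ 2 - \sum_i (x 0 i - a 0 i) ^+ 2).

Lemma bump_center a r : 0 < r -> 0 < bump a r a.
Proof.
move=> r0; rewrite /bump big1 ?subr0 ?flat_gt0 ?exprn_gt0 // => i _.
by rewrite subrr expr0n.
Qed.

(** Written as a product of segments so that its compactness is Tychonoff's theorem. *)
Definition box a r : set 'rV[R]_n :=
  [set x | forall i, `[a 0 i - r, a 0 i + r]%classic (x 0 i)].

Lemma compact_box a r : compact (box a r).
Proof. exact: (@rV_compact R n (fun i => `[a 0 i - r, a 0 i + r]%classic)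
  (fun i => @segment_compact R _ _)). Qed.

Lemma bump_out a r x : 0 < r -> ~ box a r x -> bump a r x = 0.
Proof.
move=> r0 /existsNP[i xi]; rewrite /bump /flat ifN // -leNgt subr_le0.
apply: (@le_trans _ _ ((x 0 i - a 0 i) ^+ 2)); last first.
  by rewrite (bigD1 i) //= lerDl sumr_ge0 // => j _; exact: sqr_ge0.
rewrite -(real_normK (num_real (_ - _))) ler_pXn2r ?nnegrE ?(ltW r0) //.
rewrite leNgt; apply/negP => xr; apply: xi.
by rewrite /= in_itv /= -ler_distl ltW.
Qed.

Lemma smooth_on_bump a r U : open U -> smooth_on U (bump a r).
Proof.
move=> oU k; pose d (i : 'I_n) : 'rV[R]_n -> R :=
  (fun y => y 0 i) + cst (- a 0 i).
have -> : bump a r = flat 0 \o (cst (r ^+ 2) - \sum_i d i * d i).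
  by apply/funext => x; rewrite /bump /= !fctE fct_sumE.
apply: Ck_on_flat => //; apply: smooth_onD => //; first exact: smooth_on_cst.
apply: smooth_onN => // l; apply: Ck_on_sum => // i.
have sd : smooth_on U (d i).
  by apply: smooth_onD => //; [exact: smooth_on_coord|exact: smooth_on_cst].
exact: smooth_onM.
Qed.

Lemma box_sub U a : open U -> U a -> exists2 r, 0 < r & box a r `<=` U.
Proof.
move=> oU Ua; have /nbhs_ballP[e /= e0 aU] : nbhs a U by exact: open_nbhs_nbhs.
(* The box is closed and the ball open, hence half the radius. *)
exists (e / 2) => [|x xa]; first by rewrite divr_gt0.
apply: aU; split=> // i j; rewrite (ord1 i).
have := xa j; rewrite /= in_itv /= -ler_distl distrC /ball /= => /le_lt_trans.
by apply; rewrite ltr_pdivrMr // ltr_pMr // ltr1n.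
Qed.

End Bump.

(** * From chart functions to global smooth functions *)

Section Charts.
Context {R : realType} {n : nat} (M : manifold R n).
Implicit Types (c d : chart R n M) (p : M).

Lemma chart_image_open d (O : set M) : open O ->
  open (d @` (chart_dom d `&` O)).
Proof.
move=> oO; rewrite openE => _ [q [dq Oq] <-].
have dimg : (d @` chart_dom d) (d q) by exists q.
have : nbhs (d q) (chart_inv d @^-1` O).
  apply: (chart_inv_continuous dimg).
  by rewrite /= chart_mapK //; exact: open_nbhs_nbhs.
have : nbhs (d q) (d @` chart_dom d).
  by apply: open_nbhs_nbhs; split=> //; exact: chart_img_open.
apply: filterS2 => _ [q' dq' <-] /=.
by rewrite chart_mapK // => Oq'; exists q'.
Qed.

(** Inside the domain of [c] smoothness follows from compatibility of charts. Outside it, the image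
    of [K] is compact, hence closed in the Hausdorff space, and the extension is zero on its
    complement. *)
Lemma smooth_ext0 c (G : 'rV[R]_n -> R) (K : set 'rV[R]_n) : atlas c ->
  smooth_on (c @` chart_dom c) G -> compact K -> K `<=` c @` chart_dom c ->
  (forall x, ~ K x -> G x = 0) -> is_smooth ((G \o c) \_ (chart_dom c)).
Proof.
move=> ac sG cK KU G0 d ad k.
have LK : closed (chart_inv c @` K).
  apply: compact_closed; first exact: mfd_hausdorff.
  apply: continuous_compact => //; apply: continuous_in_subspaceT => x.
  by rewrite inE => /KU; exact: chart_inv_continuous.
apply: Ck_on_local => _ [p dp <-].
have [cp|ncp] := pselect (chart_dom c p).
  exists (d @` (chart_dom d `&` chart_dom c)); first by exists p.
  have oW := chart_image_open (d := d) (chart_dom_open c).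
  apply: (@Ck_on_eq _ _ _ _ (G \o (fun x => c (chart_inv d x)))) => //.
    by move=> _ [q [dq cq] <-] /=; rewrite chart_mapK // patchE mem_set.
  apply: (Ck_on_comp_row oW (atlas_compatible ad ac)) (sG k).
  by move=> _ [q [dq cq] <-]; rewrite chart_mapK //; exists q.
exists (d @` (chart_dom d `&` ~` (chart_inv c @` K))).
  by exists p => //; split=> // -[x /KU[q cq <-]]; rewrite chart_mapK // => qp;
     apply: ncp; rewrite -qp.
have oW := chart_image_open (d := d) (closed_openC LK).
apply: (@Ck_on_eq _ _ _ _ (cst 0)) => //; last exact: Ck_on_cst.
move=> _ [q [dq Kq] <-] /=; rewrite chart_mapK // patchE.
case: ifPn => // /set_mem cq; rewrite /= G0 // => Kcq.
by apply: Kq; exists (c q) => //; rewrite chart_mapK.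
Qed.

(** * Cut-off coordinate fields and functions *)

Section LocalFrame.
Variables (c : chart R n M) (a : 'rV[R]_n) (r : R).
Hypotheses (ac : atlas c) (r0 : 0 < r) (boxU : box a r `<=` c @` chart_dom c).
Local Notation U := (c @` chart_dom c).
Local Notation psi := (bump a r).

Let oU : open U := chart_img_open c.

Lemma bump_ext_smooth G : smooth_on U G ->
  ((psi * G) \o c) \_ (chart_dom c) \in @smooth R n M.
Proof.
move=> sG; have sH : smooth_on U (psi * G).
  by apply: smooth_onM => //; exact: smooth_on_bump.
have H0 x : ~ box a r x -> (psi * G) x = 0.
  by move=> nx; rewrite !fctE bump_out // mul0r.
rewrite !inE.
exact: smooth_ext0 ac sH (@compact_box R n a r) boxU H0.
Qed.

Definition bump_ext G (sG : smooth_on U G) : smooth_fun M :=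
  SmoothFun (bump_ext_smooth sG).

Lemma smooth_on_chart (f : smooth_fun M) : smooth_on U (f \o chart_inv c).
Proof. by case: f => f /=; rewrite !inE => sf; exact: sf ac. Qed.

(** The factor [psi] lets a partial derivative of the chart act on global functions. *)
Definition bump_partial v (f : smooth_fun M) : smooth_fun M :=
  bump_ext (smooth_on_derive v (smooth_on_chart f)).

Lemma bump_extE G (sG : smooth_on U G) p :
  chart_dom c p -> bump_ext sG p = psi (c p) * G (c p).
Proof. by move=> cp; rewrite /= patchE mem_set. Qed.

Lemma bump_ext_out G (sG : smooth_on U G) p :
  ~ chart_dom c p -> bump_ext sG p = 0.
Proof. by move=> ncp; rewrite /= patchE memNset. Qed.

Lemma bump_partial_derivation v : derivation (bump_partial v).
Proof.
have dU (f : smooth_fun M) p :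
    chart_dom c p -> derivable (f \o chart_inv c) (c p) v.
  move=> cp; apply: diff_derivable.
  by apply: smooth_on_differentiable (smooth_on_chart f) _; exists p.
split=> [b f h|f h]; apply: smooth_funP => p; rewrite !smooth_funE;
  (have [cp|ncp] := pselect (chart_dom c p); last first;
    first by rewrite !bump_ext_out // !(mulr0, mul0r) addr0);
  have df := dU f p cp; have dh := dU h p cp; rewrite !bump_extE //.
  rewrite (deriveD (f := b *: (f \o chart_inv c))) ?deriveZ //.
    by rewrite /GRing.scale /=; ring.
  exact: derivableZ.
rewrite (deriveM df dh) /GRing.scale /= chart_mapK //; ring.
Qed.

Definition bump_vfield v := VField (bump_partial_derivation v).

Lemma smooth_on_shift (i : 'I_n) : smooth_on U (fun y => y 0 i - a 0 i).
Proof.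
exact: smooth_onD oU (smooth_on_coord i oU) (smooth_on_cst (- a 0 i) oU).
Qed.

Definition bump_coord i := bump_ext (smooth_on_shift i).

(** Field and coordinate each carry one factor [psi]. The coordinate is shifted to vanish at [a], so
    the derivative of [psi] contributes nothing there. *)
Lemma bump_vfield_coord i v p : chart_dom c p -> c p = a ->
  bump_vfield v (bump_coord i) p = psi a ^+ 2 * v 0 i.
Proof.
move=> cp cpa; rewrite [LHS]bump_extE // cpa.
have Ua : U a by exists p.
pose G := psi * (fun y : 'rV[R]_n => y 0 i - a 0 i).
have -> : 'D_v (bump_coord i \o chart_inv c) a = 'D_v G a.
  apply: near_eq_derive; have : nbhs a U by exact: open_nbhs_nbhs.
  apply: filterS => _ [q cq <-] /=.
  by rewrite chart_mapK // patchE mem_set.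
have dpsi : differentiable psi a.
  exact: (smooth_on_differentiable (smooth_on_bump a r oU)).
have dsh := smooth_on_differentiable (smooth_on_shift i) Ua.
rewrite deriveM; try exact: diff_derivable.
rewrite subrr scale0r addr0.
have -> : 'D_v (fun y : 'rV[R]_n => y 0 i - a 0 i) a = v 0 i.
  have -> : (fun y : 'rV[R]_n => y 0 i - a 0 i) =
      (fun y => y 0 i) + cst (- a 0 i) by [].
  rewrite deriveD ?derive_cst ?addr0 ?derive_coord //.
  exact/diff_derivable/differentiable_coord.
by rewrite /GRing.scale /= expr2 mulrA.
Qed.

End LocalFrame.

Lemma local_frame p :
  exists V : 'I_n -> vfield M, exists f : 'I_n -> smooth_fun M,
  exists2 w : R, 0 < w & forall i j, V i (f j) p = w * (i == j)%:R.
Proof.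
have [c ac cp] := atlas_cover p.
have Up : (c @` chart_dom c) (c p) by exists p.
have [r r0 boxU] := box_sub (chart_img_open c) Up.
exists (fun i => bump_vfield ac r0 boxU (delta_mx 0 i)).
exists (fun j => bump_coord ac r0 boxU j).
exists (bump (c p) r (c p) ^+ 2); first by rewrite exprn_gt0 ?bump_center.
by move=> i j; rewrite bump_vfield_coord // mxE eqxx /= eq_sym.
Qed.

End Charts.

(** Otherwise each [V i - eta (V i) *: xi] vanishes at [p]. Then [w] times the identity matrix is
    the product of a column and a row, which has rank at most one, while the dimension is at least
    two. *)
Lemma exists_nonzero_in_kernel (R : realType) n (M : manifold R n.+2)
    (xi : vfield M) (eta : one_form M) (g : metric M) (p : M) :
  eta xi = 1 -> exists2 X, eta X = 0 & 0 < g X X p.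
Proof.
move=> eta_xi; apply: contrapT => noX.
have [V [f [w w0 Vf]]] := local_frame p.
have VfE i j : w * (i == j)%:R = eta (V i) p * xi (f j) p.
  rewrite -Vf; have [X0|/(Defs.metric_pos g) X0] :=
    pselect (vanishes_at (V i - eta (V i) *: xi) p).
    by have := X0 (f j); rewrite !vf_actE !smooth_funE => /subr0_eq.
  exfalso; apply: noX; exists (V i - eta (V i) *: xi) => //.
  by rewrite linearB linearZ /= eta_xi mulr1 subrr.
have := VfE ord0 ord0; have := VfE ord_max ord_max.
have := VfE ord0 ord_max; have := VfE ord_max ord0.
rewrite !eqxx /= !mulr0 !mulr1 => H10 H01 H11 H00.
(* The minor of the first and last indices: regrouped, the diagonal product equals that of the
   off-diagonal entries, which are zero. *)
have : w * w = (eta (V ord0) p * xi (f ord_max) p) *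
               (eta (V ord_max) p * xi (f ord0) p).
  by rewrite {1}H00 H11; ring.
by rewrite -H01 mul0r => /eqP; rewrite mulf_eq0 orbb gt_eqF.
Qed.

Theorem theorem4p11 (R : realType) (M : manifold R 3)
    (phi : endo M) (xi : vfield M) (eta : one_form M) (g : metric M)
    (nabla : vfield M -> vfield M -> vfield M)
    (f1 f2 f3 f4 f5 f6 s1 s2 s3 s4 s5 s6 : smooth_fun M) :
  contact_metric phi xi eta g ->
  levi_civita g nabla ->
  (forall X Y Z : vfield M,
     curvature nabla X Y Z = sum_fR phi xi eta g f1 f2 f3 f4 f5 f6 X Y Z) ->
  (forall X Y Z : vfield M,
     curvature nabla X Y Z = sum_fR phi xi eta g s1 s2 s3 s4 s5 s6 X Y Z) ->
  (forall p : M, f1 p - f3 p < 1) ->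
  exists f fbar : smooth_fun M,
    [/\ s1 = f1 + f, s2 = f2 - (3^-1 : R) *: f, s3 = f3 + f,
        s4 = f4 + fbar & s6 = f6 + fbar].
Proof.
move=> cm lc Rf Rs f13.
have ex p : exists2 X, eta X = 0 & 0 < g X X p.
  exact: exists_nonzero_in_kernel (acm_eta_xi cm).
have [e13 e46 e12] := generalized_form_unique cm lc Rf Rs f13 ex.
exists (s1 - f1), (s4 - f4); split.
- by rewrite addrC subrK.
- by rewrite e12; apply: smooth_funP => p; rewrite !smooth_funE; field.
- by rewrite e13 addrC subrK.
- by rewrite addrC subrK.
- by rewrite e46 addrC subrK.
Qed.
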